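(* Consider the inhomogeneous renewal risk model with claim sizes $\{Z_1,Z_2,\ldots\}$, inter-occurrence times $\{\theta_1,\theta_2,\ldots\}$ and premium rate $p>0$. Suppose that, for some constants $\alpha>0$, $\beta\in\mathbb{N}$, $\varkappa>0$, $\epsilon\geqslant 0$, $\gamma>0$, $\nu_1\geqslant 1$ and $\nu_2\geqslant 1$: (i) $\displaystyle \frac1n\sum_{i=1}^n(\mathbb{E}Z_i-p\,\mathbb{E}\theta_i)\leqslant -\alpha$ for all $n\geqslant \beta$; (ii) $\displaystyle \sup_{n\geqslant\beta}\frac1n\sum_{i=1}^n\mathbb{E}\big(\theta_i\mathbf{1}_{\{\theta_i\geqslant \varkappa/p\}}\big)\leqslant\epsilon$; (iii) $\displaystyle \sup_{n\geqslant\beta}\frac1n\sum_{i=1}^n\mathbb{E}\,e^{\gamma Z_i}\leqslant\nu_1$; (iv) $\displaystyle \max_{1\leqslant n\leqslant\beta-1}\frac1n\sum_{i=1}^n\mathbb{E}\,e^{\gamma Z_i}\leqslant\nu_2$. If $$-\hat{\Delta}:=p\,\epsilon+\delta\gamma(1+\nu_1)\max\Big\{\frac{\varkappa^2}{2},\frac{2}{\gamma^2}\Big\}-\alpha<0$$ for some $\delta\in(0,1/2]$, then the ruin probability of the model satisfies $$\psi(u)\leqslant\min\big\{1,\,c_2e^{-\delta\gamma u}\big\},\qquad u\geqslant 0,$$ with the positive constant $$c_2=\frac{1+\nu_2}{\nu_2}\Big((1+\nu_2)^{\beta-1}-1\Big)+\frac{\exp\{-\delta\gamma\hat{\Delta}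\beta\}}{1-\exp\{-\delta\gamma\hat{\Delta}\}}.$$
   Context: Inhomogeneous renewal risk model: the insurer's surplus process is $$R(t)=u+pt-\sum_{i=1}^{\Theta(t)}Z_i,\qquad t\geqslant 0,$$ where $u\geqslant 0$ is the initial surplus; $p>0$ is a constant premium rate; the claim sizes $\{Z_1,Z_2,\ldots\}$ are independent nonnegative, not necessarily identically distributed random variables; $\Theta(t)=\sum_{n=1}^\infty \mathbf{1}_{\{\theta_1+\cdots+\theta_n\leqslant t\}}$ is the renewal counting process generated by the inter-occurrence times $\{\theta_1,\theta_2,\ldots\}$, which are independent nonnegative random variables, nondegenerate at zero and possibly not identically distributed; and the sequences $\{Z_1,Z_2,\ldots\}$ and $\{\theta_1,\theta_2,\ldots\}$ are independent of each other. The (ultimate) ruin probability is $$\psi(u)=\mathbb{P}\Big(\inf_{t\geqslant 0}R(t)<0\Big)=\mathbb{P}\Big(\sup_{n\geqslant 1}\sum_{k=1}^n(Z_k-p\,\theta_k)>u\Big).$$ $\mathbf{1}_A$ denotes the indicator of the event $A$, $\mathbb{N}=\{1,2,\ldots\}$, and empty sums are zero. When $\beta=1$, condition (iv) ranges over no $n$ and is vacuous. *)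

(* Defs.v *)
(* Random sequences are 0-based: [Z i] and [theta i] stand for Z_(i+1) and
   theta_(i+1), so sums over 1 <= i <= n become sums over i < n. *)
From HB Require Import structures.
From mathcomp Require Export all_boot all_order all_algebra.
From mathcomp Require Export all_classical all_reals all_analysis.
Export Order.TTheory GRing.Theory Num.Theory.
Export numFieldNormedType.Exports.

Set Implicit Arguments.
Unset Strict Implicit.
Unset Printing Implicit Defensive.

Local Open Scope classical_set_scope.
Local Open Scope ring_scope.
Local Open Scope ereal_scope.

(* Mutual independence: product rule for every finite set of indices; the
   library does not provide independence of random variables. *)
Definition independent_RVs (d : measure_display) (T : measurableType d)
    (R : realType) (P : probability T R) (X : nat -> {RV P >-> R}) : Prop :=
  forall (s : seq nat) (B : nat -> set R), uniq s ->
    (forall i, i \in s -> measurable (B i)) ->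
    P [set w | forall i, i \in s -> B i (X i w)] =
    \prod_(i <- s) P (X i @^-1` B i).

Definition sigma_of_sequence (d : measure_display) (T : measurableType d)
    (R : realType) (P : probability T R) (X : nat -> {RV P >-> R}) :
    set (set T) :=
  <<s \bigcup_i preimage_set_system [set: T] (X i) measurable >>.

Definition independent_sequences (d : measure_display) (T : measurableType d)
    (R : realType) (P : probability T R) (X Y : nat -> {RV P >-> R}) : Prop :=
  forall A B : set T, sigma_of_sequence X A -> sigma_of_sequence Y B ->
    P (A `&` B) = P A * P B.

Record inhomogeneous_renewal_risk_model (d : measure_display)
    (T : measurableType d) (R : realType) (P : probability T R) (p : R)
    (Z theta : nat -> {RV P >-> R}) : Prop := InhomogeneousRenewalRiskModel {
  premium_gt0 : (0 < p)%R ;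
  claim_ge0 : forall i w, (0 <= Z i w)%R ;
  claim_indep : independent_RVs Z ;
  interoccurrence_ge0 : forall i w, (0 <= theta i w)%R ;
  interoccurrence_nondegenerate : forall i, P (theta i @^-1` [set 0%R]) < 1 ;
  interoccurrence_indep : independent_RVs theta ;
  claim_interoccurrence_indep : independent_sequences Z theta }.

(* Extended-real valued: infinitely many claims may occur before time t at
   some sample points. *)
Definition renewal_count (d : measure_display) (T : measurableType d)
    (R : realType) (P : probability T R) (theta : nat -> {RV P >-> R})
    (t : R) (w : T) : \bar R :=
  \sum_(0 <= n <oo) (\1_[set w' | (\sum_(i < n.+1) theta i w' <= t)%R] w)%:E.

Definition surplus (d : measure_display) (T : measurableType d)
    (R : realType) (P : probability T R) (p : R)
    (Z theta : nat -> {RV P >-> R}) (u t : R) (w : T) : \bar R :=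
  (u + p * t)%:E -
  \sum_(0 <= i <oo | i.+1%:R%:E <= renewal_count theta t w) (Z i w)%:E.

Definition ruin_probability (d : measure_display) (T : measurableType d)
    (R : realType) (P : probability T R) (p : R)
    (Z theta : nat -> {RV P >-> R}) (u : R) : \bar R :=
  P [set w | ereal_inf [set surplus p Z theta u t w | t in `[0%R, +oo[] < 0].

(* Main.v *)
(* Every path on which ruin occurs has a partial sum S_n of Z_k - p theta_k above
   u, reached at the n-th claim, so the ruin event is the union over n >= 1 of
   {S_n > u}. With y = delta * gamma, Markov's inequality gives
   P(S_n > u) <= e^(-yu) prod_(i < n) E e^(y xi_i), xi_i = Z_i - p theta_i, and by
   AM-GM the product is at most the n-th power of the average of its factors.
   For n < beta the average is at most nu2 by (iv). For n >= beta, a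
   second-order bound of e^(y xi) that only uses the tail of theta when
   p theta >= kappa turns (i)-(iii) into an average of at most
   1 - y Delta <= e^(-y Delta). Summing the two geometric series gives c2. *)
Require Import Defs.
From mathcomp Require Import measurable_realfun simple_functions ring lra.

Set Implicit Arguments.
Unset Strict Implicit.
Unset Printing Implicit Defensive.

Local Open Scope classical_set_scope.
Local Open Scope ring_scope.
Local Open Scope ereal_scope.

(** * Expectation of products of independent random variables *)

Section ConditionedIntegral.
Import HBNNSimple.

(** By hypothesis the measure weighted by G, pushed forward by X, is c times the law of X. Integrals
    of f then agree as well: first for simple functions, then by monotone limits. *)
Lemma ge0_integral_mul_comp (d : measure_display) (T : measurableType d)
    (R : realType) (P : probability T R) (G X : T -> R) (c : R) (f : R -> R) :
  measurable_fun [set: T] G -> (forall w, (0 <= G w)%R) ->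
  measurable_fun [set: T] X -> (0 <= c)%R ->
  (forall B, measurable B ->
     \int[P]_w (G w * \1_B (X w))%:E = c%:E * P (X @^-1` B)) ->
  measurable_fun [set: R] f -> (forall x, (0 <= f x)%R) ->
  \int[P]_w (G w * f (X w))%:E = c%:E * \int[P]_w (f (X w))%:E.
Proof.
move=> mG G0 mX c0 GX mf f0.
have mEf : measurable_fun [set: R] (fun x => (f x)%:E) by exact/measurable_EFinP.
pose h := nnsfun_approx measurableT mEf.
have h0 n x : (0 <= h n x)%R by exact: fun_ge0.
have mh n : measurable_fun [set: T] (h n \o X) by exact: measurableT_comp.
have hcvg x : (h n x)%:E @[n --> \oo] --> (f x)%:E.
  by apply: (@cvg_nnsfun_approx _ _ _ _ measurableT _ mEf) => // y _; rewrite lee_fin.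
have hnd x : {homo (fun n => h n x) : a b / (a <= b)%N >-> (a <= b)%R}.
  by move=> a b ab; exact/lefP/nd_nnsfun_approx.
have hstep n : \int[P]_w (G w * h n (X w))%:E = c%:E * \int[P]_w (h n (X w))%:E.
  have mi r : measurable (h n @^-1` [set r]) by exact: measurable_sfunP.
  have mpre r : measurable (X @^-1` (h n @^-1` [set r])).
    by rewrite -[X in measurable X]setTI; exact: mX.
  under eq_integral do rewrite fimfunE mulr_fsumr -fsumEFin//.
  under [in RHS]eq_integral do rewrite fimfunE -fsumEFin//.
  have m1 r : measurable_fun [set: T] (fun w => \1_(h n @^-1` [set r]) (X w) : R).
    apply: (@measurableT_comp _ _ _ _ _ _ (\1_(h n @^-1` [set r]) : R -> R)) => //.
  have i0 r w : (0 <= r * \1_(h n @^-1` [set r]) (X w))%R.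
    by have := nnfun_muleindic_ge0 (h n) r (X w); rewrite -EFinM lee_fin.
  rewrite !ge0_integral_fsum//.
  - rewrite ge0_mule_fsumr; last first.
      by move=> r; apply: integral_ge0 => w _; rewrite lee_fin.
    apply: eq_fsbigr => r _.
    (* [h n] takes no negative value, so for r < 0 the preimage is empty and both terms vanish. *)
    have [r0|r0] := leP 0%R r; last first.
      rewrite preimage_nnfun0//.
      by rewrite !integral0_eq ?mule0// => w _; rewrite indicE in_set0 !mulr0.
    under eq_integral do rewrite mulrCA EFinM.
    under [in RHS]eq_integral do rewrite EFinM.
    rewrite !ge0_integralZl//.
    + rewrite GX// muleCA; congr (_ * (_ * _)).
      rewrite (_ : (fun _ => _) = EFin \o \1_(X @^-1` (h n @^-1` [set r])))//.
      by rewrite integral_indic ?setIT.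
    + exact/measurable_EFinP.
    + by apply/measurable_EFinP; exact: measurable_funM.
    + by move=> w _; rewrite lee_fin mulr_ge0.
  - by move=> r; apply/measurable_EFinP; exact: measurable_funM.
  - by move=> r w _; rewrite lee_fin.
  - move=> r; apply/measurable_EFinP; apply: measurable_funM => //.
    exact: measurable_funM.
  - by move=> r w _; rewrite lee_fin mulr_ge0.
(* Monotone convergence on both sides: [h n] increases to f and G is nonnegative. *)
transitivity (limn (fun n => \int[P]_w (G w * h n (X w))%:E)).
  rewrite -monotone_convergence//=.
  - apply: eq_integral => w _; apply/esym/cvg_lim => //.
    under eq_fun do rewrite EFinM.
    by rewrite EFinM; apply: cvgeZl.
  - by move=> n; apply/measurable_EFinP; apply: measurable_funM => //; exact: mh.
  - by move=> n w _; rewrite lee_fin mulr_ge0.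
  - by move=> w _ a b ab; rewrite lee_fin ler_wpM2l// hnd.
under eq_fun do rewrite hstep.
rewrite limeMl//; last first.
  apply/ereal_nondecreasing_is_cvgn => a b ab; apply: ge0_le_integral => //.
  - by move=> w _; rewrite lee_fin.
  - apply/measurable_EFinP; exact: mh.
  - apply/measurable_EFinP; exact: mh.
  - by move=> w _; rewrite lee_fin hnd.
congr (_ * _); rewrite -monotone_convergence//=.
- by apply: eq_integral => w _; exact/cvg_lim.
- by move=> n; apply/measurable_EFinP; exact: mh.
- by move=> n w _; rewrite lee_fin.
- by move=> w _ a b ab; rewrite lee_fin hnd.
Qed.

End ConditionedIntegral.

Lemma prod_indic (R : pzRingType) (T I : Type) (s : seq I) (A : I -> set T) (w : T) :
  (\prod_(i <- s) \1_(A i) w = \1_(\big[setI/setT]_(i <- s) A i) w :> R)%R.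
Proof.
elim: s => [|a s IH]; first by rewrite !big_nil indicT.
by rewrite !big_cons indicI IH.
Qed.

Section IndependentFamily.
Context (d : measure_display) (T : measurableType d) (R : realType)
  (P : probability T R) (I : choiceType) (X : I -> {RV P >-> R}).
Hypothesis X_indep : forall (s : seq I) (B : I -> set R), uniq s ->
  (forall i, i \in s -> measurable (B i)) ->
  P [set w | forall i, i \in s -> B i (X i w)] = \prod_(i <- s) P (X i @^-1` B i).

(* The indicators are replaced by [f] one index at a time: for the other factors
   fixed, both sides are measures in the set [B a], and [ge0_integral_mul_comp]
   passes from sets to functions. *)
Lemma integral_prod_indep_indic (f : I -> R -> R) (c : I -> R) (s1 s2 : seq I)
    (B : I -> set R) :
  (forall i, measurable_fun [set: R] (f i)) -> (forall i x, (0 <= f i x)%R) ->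
  uniq (s1 ++ s2) ->
  (forall i, i \in s1 -> \int[P]_w (f i (X i w))%:E = (c i)%:E) ->
  (forall i, measurable (B i)) ->
  \int[P]_w ((\prod_(i <- s1) f i (X i w)) * \prod_(i <- s2) \1_(B i) (X i w))%:E =
  (\prod_(i <- s1) c i)%:E * \prod_(i <- s2) P (X i @^-1` B i).
Proof.
move=> mf f0; elim: s1 s2 B => [|a s1 IH] s2 B us fc mB.
  have mX i : measurable (X i @^-1` B i) by exact: measurable_sfunP.
  under eq_integral do rewrite big_nil mul1r.
  rewrite big_nil mul1e -X_indep//.
  rewrite (_ : [set w | _] = \big[setI/setT]_(i <- s2) (X i @^-1` B i)); last first.
    by rewrite -bigcap_seq.
  rewrite -[X in P X]setIT -integral_indic//; last exact: bigsetI_measurable.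
  by apply: eq_integral => w _; rewrite -prod_indic.
move: us => /=; rewrite mem_cat negb_or => /andP[/andP[as1 as2] us].
pose q := \prod_(i <- s2) P (X i @^-1` B i).
have q_fin : q \is a fin_num.
  rewrite /q; elim/big_rec : _ => // i x _ xf; apply: fin_numM => //.
  by apply: fin_num_measure; exact: measurable_sfunP.
have q0 : 0 <= q by apply: prode_ge0.
have c0 : (0 <= \prod_(i <- s1) c i)%R.
  rewrite big_seq; apply: prodr_ge0 => i is1; rewrite -lee_fin -fc ?inE ?is1 ?orbT//.
  by apply: integral_ge0 => w _; rewrite lee_fin.
(* The factor of index a goes to the right; the remaining product is the weight G. *)
under eq_integral do rewrite big_cons -mulrA mulrC.
have := @ge0_integral_mul_comp _ _ _ P
  (fun w => (\prod_(i <- s1) f i (X i w)) * \prod_(i <- s2) \1_(B i) (X i w))%R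
  (X a) (\prod_(i <- s1) c i * fine q)%R (f a).
rewrite EFinM fineK// fc ?mem_head// => ->//.
- by rewrite big_cons mulrC EFinM -!muleA; congr (_ * _); rewrite muleC.
- by apply: measurable_funM; apply: measurable_prod => i _ //; apply: measurableT_comp.
- by move=> w; rewrite mulr_ge0// prodr_ge0.
- by rewrite mulr_ge0// fine_ge0.
- move=> A mA.
  (* Placing A at index a gives an instance of the induction hypothesis, with a moved to the list of
     indicators. *)
  pose B' i := if i == a then A else B i.
  have B'E i : i \in s2 -> B' i = B i.
    by rewrite /B'; case: eqP => // -> as2'; rewrite as2' in as2.
  have B'a : B' a = A by rewrite /B' eqxx.
  have := IH (a :: s2) B'; rewrite big_cons B'a.
  rewrite (eq_big_seq _ (fun i is2 => congr1 (fun S => P (X i @^-1` S)) (B'E i is2))).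
  rewrite -/q muleA [X in _ = X]muleAC => <-.
  + apply: eq_integral => w _; rewrite big_cons B'a -mulrA; congr (_ * _)%:E.
    rewrite mulrC; congr (_ * _)%R.
    by apply: eq_big_seq => i is2; rewrite B'E.
  + by rewrite uniq_catC /= mem_cat negb_or as1 as2 uniq_catC.
  + by move=> i is1; apply: fc; rewrite inE is1 orbT.
  + by move=> i; rewrite /B'; case: ifP.
Qed.

Lemma integral_prod_indep (f : I -> R -> R) (c : I -> R) (s : seq I) :
  (forall i, measurable_fun [set: R] (f i)) -> (forall i x, (0 <= f i x)%R) ->
  uniq s -> (forall i, i \in s -> \int[P]_w (f i (X i w))%:E = (c i)%:E) ->
  \int[P]_w (\prod_(i <- s) f i (X i w))%:E = (\prod_(i <- s) c i)%:E.
Proof.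
move=> mf f0 us fc.
have := @integral_prod_indep_indic f c s [::] (fun=> setT) mf f0.
rewrite cats0 big_nil mule1 => <- //.
by apply: eq_integral => w _; rewrite big_nil mulr1.
Qed.

End IndependentFamily.

(** A disjoint sum of indices makes one family of two sequences, so that a single product rule
    covers both. *)
Definition merge_sequences (d : measure_display) (T : measurableType d)
    (R : realType) (P : probability T R) (X Y : nat -> {RV P >-> R})
    (i : nat + nat) : {RV P >-> R} :=
  match i with inl j => X j | inr j => Y j end.

(** Brings finite-dimensional events into the form that [independent_sequences] accepts. *)
Lemma sigma_of_sequence_bigsetI (d : measure_display) (T : measurableType d)
    (R : realType) (P : probability T R) (X : nat -> {RV P >-> R})
    (s : seq nat) (B : nat -> set R) :
  (forall i, i \in s -> measurable (B i)) ->
  sigma_of_sequence X [set w | forall i, i \in s -> B i (X i w)].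
Proof.
move=> mB.
pose G := \bigcup_i preimage_set_system [set: T] (X i) measurable.
rewrite (_ : [set w | _] = \bigcap_(i in [set` s]) (X i @^-1` B i))//.
have := @fin_bigcap_measurable _ (g_sigma_algebraType G) _ [set` s]
  (fun i => X i @^-1` B i).
apply => // i /= is1.
by apply: sub_sigma_algebra; exists i => //; exists (B i); [exact: mB|rewrite setTI].
Qed.

(** The index list splits by tag into [l] and [r]. Independence of the two sequences separates the
    two events, and the product rule of each sequence does the rest. *)
Lemma merge_sequences_indep (d : measure_display) (T : measurableType d)
    (R : realType) (P : probability T R) (X Y : nat -> {RV P >-> R}) :
  independent_RVs X -> independent_RVs Y -> independent_sequences X Y ->
  forall (s : seq (nat + nat)) (B : nat + nat -> set R), uniq s ->
  (forall i, i \in s -> measurable (B i)) ->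
  P [set w | forall i, i \in s -> B i (merge_sequences X Y i w)] =
  \prod_(i <- s) P (merge_sequences X Y i @^-1` B i).
Proof.
move=> iX iY iXY s B us mB.
pose l := pmap (fun x : nat + nat => if x is inl i then Some i else None) s.
pose r := pmap (fun x : nat + nat => if x is inr i then Some i else None) s.
have lE i : (i \in l) = (inl i \in s).
  rewrite mem_pmap; elim: (s) => //= -[] x t IHt; rewrite !inE IHt//.
have rE i : (i \in r) = (inr i \in s).
  rewrite mem_pmap; elim: (s) => //= -[] x t IHt; rewrite !inE IHt//.
have ul : uniq l by rewrite (pmap_uniq (g := inl))//; case.
have ur : uniq r by rewrite (pmap_uniq (g := inr))//; case.
rewrite (_ : [set w | _] =
    [set w | forall i, i \in l -> (B \o inl) i (X i w)] `&`
    [set w | forall i, i \in r -> (B \o inr) i (Y i w)]); last first.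
  apply/seteqP; split => w /=.
    by move=> h; split=> i; rewrite ?lE ?rE => /h.
  by move=> [hl hr] [] i is1; [apply: hl; rewrite lE|apply: hr; rewrite rE].
rewrite iXY; last 2 first.
  by apply: sigma_of_sequence_bigsetI => i; rewrite lE => /mB.
  by apply: sigma_of_sequence_bigsetI => i; rewrite rE => /mB.
rewrite iX//; last by move=> i; rewrite lE => /mB.
rewrite iY//; last by move=> i; rewrite rE => /mB.
rewrite /l /r; elim: (s) => [|[] x t IHt] /=; first by rewrite !big_nil mule1.
  by rewrite !big_cons -IHt muleA.
by rewrite !big_cons -IHt muleCA.
Qed.

(** The exponential of the sum is a product over two tagged copies of s, one with rate y and one
    with rate z. *)
Lemma integral_expR_sum_indep (d : measure_display) (T : measurableType d)
    (R : realType) (P : probability T R) (X Y : nat -> {RV P >-> R})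
    (y z : R) (a b : nat -> R) (s : seq nat) :
  independent_RVs X -> independent_RVs Y -> independent_sequences X Y -> uniq s ->
  (forall i, i \in s -> \int[P]_w (expR (y * X i w))%:E = (a i)%:E) ->
  (forall i, i \in s -> \int[P]_w (expR (z * Y i w))%:E = (b i)%:E) ->
  \int[P]_w (expR (\sum_(i <- s) (y * X i w + z * Y i w)))%:E =
  (\prod_(i <- s) (a i * b i))%:E.
Proof.
move=> iX iY iXY us Xa Yb.
have := @integral_prod_indep _ _ _ P _ (merge_sequences X Y)
  (merge_sequences_indep iX iY iXY)
  (fun i x => match i with inl _ => expR (y * x) | inr _ => expR (z * x) end)
  (fun i => match i with inl i => a i | inr i => b i end)
  (map inl s ++ map inr s).
rewrite big_cat !big_map big_split => <- //.
- apply: eq_integral => w _; rewrite big_cat !big_map expR_sum /=; congr EFin.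
  by under [LHS]eq_bigr do rewrite expRD; rewrite big_split.
- by case=> i; apply: measurableT_comp => //; exact: measurable_funM.
- by case=> i x; exact: expR_ge0.
- rewrite cat_uniq !map_inj_uniq ?us ?andbT//=; try by move=> ? ? [].
  by apply/hasPn => _ /mapP[i _ ->]; apply/mapP => -[].
- move=> i; rewrite mem_cat => /orP[] /mapP[j js ->]; [exact: Xa|exact: Yb].
Qed.

(** * The ruin event *)

Lemma sumr_ord_nd (R : numDomainType) (a : nat -> R) (m n : nat) :
  (forall j, 0 <= a j)%R -> (m <= n)%N -> (\sum_(j < m) a j <= \sum_(j < n) a j)%R.
Proof.
move=> a0 mn; rewrite -!(big_mkord xpredT a).
by rewrite [leRHS](@big_cat_nat _ _ _ m)//= lerDl sumr_ge0.
Qed.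

(** Nonnegative gaps make the arrival times nondecreasing, so the indicators equal to 1 form an
    initial segment. *)
Lemma le_renewal_count (d : measure_display) (T : measurableType d) (R : realType)
    (P : probability T R) (theta : nat -> {RV P >-> R}) (t : R) (w : T) (i : nat) :
  (forall j, (0 <= theta j w)%R) ->
  (i.+1%:R%:E <= renewal_count theta t w) = (\sum_(j < i.+1) theta j w <= t)%R.
Proof.
move=> theta0.
pose arr n := [set w' | (\sum_(j < n.+1) theta j w' <= t)%R].
have ge0 n : 0 <= (\1_(arr n) w)%:E :> \bar R by rewrite lee_fin.
have [Ti|Ti] := leP (\sum_(j < i.+1) theta j w)%R t.
- apply: le_trans (nneseries_lim_ge i.+1 _); last by move=> n _ _; exact: ge0.
  rewrite sumEFin lee_fin (eq_big_nat _ _ (F2 := fun=> 1%R)).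
    by rewrite sumr_const_nat subn0.
  by move=> n /andP[_ ni]; rewrite indicE mem_set//=;
    exact: le_trans (sumr_ord_nd theta0 ni) Ti.
(* Every indicator from index i on is 0, and the first i of them add up to at most i. *)
- apply/negbTE; rewrite -ltNge /renewal_count (nneseries_split 0 i)//.
  rewrite [X in _ + X]eseries0 ?adde0; last first.
    move=> n /= ni _; rewrite indicE memNset//=.
    move=> /(le_trans (sumr_ord_nd theta0 (ni : i.+1 <= n.+1)%N)).
    by rewrite leNgt Ti.
  rewrite add0n sumEFin lte_fin; apply: (@le_lt_trans _ _ i%:R%R); last by rewrite ltr_nat.
  rewrite -[X in (_ <= X%:R)%R]subn0 -sumr_const_nat; apply: ler_sum => n _.
  by rewrite indicE; case: (_ \in _).
Qed.

(** Reduces a path with infinitely many claims before time t to finitely many of them: if all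
    partial sums were at most x, so would be their limit. *)
Lemma lt_nneseries_partial (R : realType) (a : nat -> \bar R) (Q : pred nat) (x : \bar R) :
  (forall n, 0 <= a n) -> x < \sum_(0 <= n <oo | Q n) a n ->
  exists N, x < \sum_(0 <= n < N | Q n) a n.
Proof.
move=> a0 xa; apply/not_existsP => le_x; move: xa; apply/negP; rewrite -leNgt.
apply: lime_le; first by apply: is_cvg_nneseries.
by apply: nearW => N; rewrite leNgt; exact/negP.
Qed.

(** Between claims the surplus does not decrease, so a negative value at time t forces a partial sum
    above u at some claim arrived by t. *)
Lemma ruin_eventE (d : measure_display) (T : measurableType d) (R : realType)
    (P : probability T R) (p : R) (Z theta : nat -> {RV P >-> R}) (u : R) :
  (0 <= p)%R -> (forall i w, (0 <= Z i w)%R) -> (forall i w, (0 <= theta i w)%R) ->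
  (0 <= u)%R ->
  [set w | ereal_inf [set surplus p Z theta u t w | t in `[0%R, +oo[] < 0] =
  \bigcup_n [set w | (u < \sum_(i < n.+1) (Z i w - p * theta i w))%R].
Proof.
move=> p0 Z0 theta0 u0.
have surplus_lt0 t w : (surplus p Z theta u t w < 0) =
    ((u + p * t)%:E < \sum_(0 <= i <oo | (\sum_(j < i.+1) theta j w <= t)%R) (Z i w)%:E).
  rewrite /surplus sube_lt0//
    (eq_eseriesl (Q := fun i => (\sum_(j < i.+1) theta j w <= t)%R))//.
  by move=> i; exact: le_renewal_count.
apply/seteqP; split => w /=.
- move=> /ereal_inf_lt[_ [t t0 <-]].
  move: t0; rewrite /= in_itv/= andbT => t0.
  rewrite surplus_lt0 => /lt_nneseries_partial[|N]; first by move=> n; rewrite lee_fin.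
  (* Induction strips claims arriving after t from the end of the sum until the last one has arrived
     by t; the empty sum cannot exceed u + p t >= 0. *)
  rewrite sumEFin lte_fin; elim: N => [|N IH].
    by rewrite big_geq// ltNge addr_ge0 ?mulr_ge0.
  have [TN|TN] := leP (\sum_(j < N.+1) theta j w)%R t; last first.
    by rewrite big_mkcond big_nat_recr//= leNgt TN addr0 -big_mkcond.
  move=> uZ; exists N => //=; rewrite sumrB -mulr_sumr ltrBrDr.
  apply: (@le_lt_trans _ _ (u + p * t)%R); first by rewrite lerD2l ler_wpM2l.
  apply: lt_le_trans uZ _; rewrite big_mkord big_mkcond/=.
  by apply: ler_sum => i _; case: ifP.
- move=> [n _ /=]; rewrite sumrB -mulr_sumr ltrBrDr => uS.
  (* At the arrival time of claim n+1 the first n+1 claims have all been paid. *)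
  pose t := (\sum_(j < n.+1) theta j w)%R.
  apply/ereal_inf_ltP; exists (surplus p Z theta u t w).
    by exists t => //=; rewrite in_itv/= andbT sumr_ge0.
  rewrite surplus_lt0; apply: lt_le_trans (nneseries_lim_ge n.+1 _); last first.
    by move=> i _ _; rewrite lee_fin.
  rewrite big_mkcond/= big_mkord (eq_bigr (fun i : 'I_n.+1 => (Z i w)%:E)).
    by rewrite sumEFin lte_fin.
  by move=> i _; rewrite /t (sumr_ord_nd (a := fun j => theta j w)).
Qed.

(** * Moment generating function bounds *)

Section ExponentialBounds.
Local Open Scope ring_scope.

Lemma expR_double (R : realType) (x : R) : expR x = expR (x / 2) ^+ 2.
Proof. by rewrite expr2 -expRD; congr expR; field. Qed.

(* The constant is not the optimal 1/2, but any c with 16 c / e^2 <= 2 is enough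
   for [expR_increment_le], and 3/4 needs only [1 + x <= e^x]. *)
Lemma expR_remainder_le (R : realType) (x : R) : 0 <= x ->
  expR x - 1 - x <= 3 / 4 * x ^+ 2 * expR x.
Proof.
move=> x0; rewrite (expR_double x).
have v1 : 1 <= expR (x / 2) by rewrite -expR0 ler_expR divr_ge0.
have vx : expR (x / 2) - 1 <= x / 2 * expR (x / 2).
  have := expR_ge1Dx (- (x / 2)); rewrite expRN => h.
  have := ler_wpM2r (expR_ge0 (x / 2)) h; rewrite mulVf ?expR_eq0//; lra.
move: (expR _) v1 vx => v v1 vx.
(* With v for e^(x/2), the right side minus the left side is the expression of [h2] plus half of
   those of [h1] and [h3]. *)
have h1 : 0 <= x * (v + 2) * (x / 2 * v - (v - 1)) by rewrite !mulr_ge0//; lra.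
have h2 : 0 <= (v + 1) * (x / 2 * v - (v - 1)) by rewrite mulr_ge0//; lra.
have h3 : 0 <= x ^+ 2 * v * (v - 1) by rewrite !mulr_ge0//; lra.
nra.
Qed.

(** The ratio s^2 / e^(s/2) peaks at s = 4 with value 16 / e^2, so the claim comes down to e^2 >= 6.
    The peak bound is 1 + x <= e^x at x = s/4 - 1, squared. *)
Lemma sqr_le_expR_half (R : realType) (s : R) : 0 <= s ->
  3 / 4 * s ^+ 2 <= 2 * expR (s / 2).
Proof.
move=> s0.
(* Sixteen factors e^(1/8) >= 9/8 give (9/8)^16, about 6.58. *)
have e2 : 6 <= expR 2 :> R.
  have -> : 2 = 16%:R * (1 / 8) :> R by field.
  rewrite expRM_natl; apply: (@le_trans _ _ ((1 + 1 / 8) ^+ 16)); first lra.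
  by rewrite lerXn2r ?nnegrE ?expR_ge0 ?expR_ge1Dx//; lra.
have h : (s / 4) ^+ 2 <= expR (s / 2 - 2).
  have -> : s / 2 - 2 = (s / 4 - 1) * 2 by field.
  rewrite (expR_double (_ * 2)) mulfK//.
  have := expR_ge1Dx (s / 4 - 1); rewrite addrC subrK => h.
  by rewrite lerXn2r ?nnegrE ?expR_ge0//; lra.
have -> : s / 2 = (s / 2 - 2) + 2 by field.
rewrite expRD; nra.
Qed.

(** The term y p t stands on the left so that both sides are nonnegative and can be integrated
    without subtraction. With xi = z - p t the cases are xi >= 0; xi < 0 with t >= kappa/p; and
    -kappa < xi < 0. *)
Lemma expR_increment_le (R : realType) (p kappa gamma y z t : R) :
  0 < p -> 0 < kappa -> 0 < gamma -> 0 < y -> y <= gamma / 2 ->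
  0 <= z -> 0 <= t ->
  expR (y * z + - (y * p) * t) + y * p * t <=
  1 + y * z + y * p * (t * (kappa / p <= t)%R%:R)
  + y ^+ 2 * Num.max (kappa ^+ 2 / 2) (2 / gamma ^+ 2) * (1 + expR (gamma * z)).
Proof.
move=> p0 k0 g0 y0 yg z0 t0.
set M := Num.max _ _.
have Mk : kappa ^+ 2 / 2 <= M by rewrite le_max lexx.
have Mg : 2 / gamma ^+ 2 <= M by rewrite le_max lexx orbT.
have ez : 1 <= expR (gamma * z) by rewrite -expR0 ler_expR mulr_ge0// ltW.
pose xi := z - p * t.
have -> : y * z + - (y * p) * t = y * xi by rewrite /xi; ring.
have M0 : 0 <= M by apply: le_trans Mk; nra.
have KM : 0 <= y ^+ 2 * M by nra.
have [xi0|xi0] := leP 0 xi.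
(* Since y <= gamma/2, e^(y xi) is at most e^(gamma xi / 2); a second such factor absorbs the square
   by [sqr_le_expR_half], which yields the constant 2/gamma^2. *)
- have xz : xi <= z by rewrite /xi; nra.
  have ind0 : 0 <= y * p * (t * (kappa / p <= t)%R%:R) by rewrite !mulr_ge0// ltW.
  have h1 := expR_remainder_le (mulr_ge0 (ltW y0) xi0).
  have h2 := sqr_le_expR_half (mulr_ge0 (ltW g0) xi0).
  have h3 : expR (y * xi) <= expR (gamma * xi / 2) by rewrite ler_expR; nra.
  have h4 : expR (gamma * xi) <= expR (gamma * z) by rewrite ler_expR; nra.
  have h5 : expR (gamma * xi) = expR (gamma * xi / 2) ^+ 2 by exact: expR_double.
  have h6 : 3 / 4 * (y * xi) ^+ 2 * expR (y * xi) <= y ^+ 2 * M * expR (gamma * z).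
    apply: (@le_trans _ _ (3 / 4 * (y * xi) ^+ 2 * expR (gamma * xi / 2))).
      by apply: ler_wpM2l => //; nra.
    apply: (@le_trans _ _ (y ^+ 2 * (2 / gamma ^+ 2) * expR (gamma * z))); last first.
      by apply: ler_wpM2r; [exact: expR_ge0 | apply: ler_wpM2l => //; nra].
    apply: (@le_trans _ _ (y ^+ 2 * (2 / gamma ^+ 2) * expR (gamma * xi))); last first.
      by apply: ler_wpM2l => //; rewrite mulr_ge0 ?sqr_ge0// divr_ge0// sqr_ge0.
    rewrite h5; have -> : 3 / 4 * (y * xi) ^+ 2 * expR (gamma * xi / 2) =
      y ^+ 2 / gamma ^+ 2 * ((3 / 4 * (gamma * xi) ^+ 2) * expR (gamma * xi / 2)).
      by field; rewrite gt_eqF.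
    have -> : y ^+ 2 * (2 / gamma ^+ 2) * expR (gamma * xi / 2) ^+ 2 =
      y ^+ 2 / gamma ^+ 2 * ((2 * expR (gamma * xi / 2)) * expR (gamma * xi / 2)).
      by field; rewrite gt_eqF.
    apply: ler_wpM2l; first by rewrite divr_ge0// sqr_ge0.
    by apply: ler_wpM2r => //; exact: expR_ge0.
  rewrite /xi in h1 h6 *; nra.
have [kt|kt] := leP (kappa / p) t.
(* The indicator is 1 and its term cancels y p t, leaving e^(y xi) <= 1. *)
- rewrite mulr1.
  have h1 : expR (y * xi) <= 1 by rewrite -expR0 ler_expR; nra.
  nra.
rewrite mulr0 mulr0.
have kxi : - kappa < xi.
  by move: kt; rewrite ltr_pdivlMr// /xi; nra.
(* For x <= 0, (1 - x) e^x <= 1 <= (1 - x) (1 + x + x^2). Coefficient 1 of the square suffices: 1 +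
   e^(gamma z) >= 2 makes up for the half in kappa^2/2. *)
have h1 : expR (y * xi) <= 1 + y * xi + (y * xi) ^+ 2.
  have ht : 0 <= - (y * xi) by nra.
  have := expR_ge1Dx (- (y * xi)); rewrite expRN => h.
  have e0 := expR_gt0 (y * xi).
  have := ler_wpM2r (ltW e0) h; rewrite mulVf ?expR_eq0//.
  move: (expR (y * xi)) e0 => e e0 he.
  move: (y * xi) ht he => x ht he.
  have : (1 - x) * e <= (1 - x) * (1 + x + x ^+ 2) by nra.
  by rewrite ler_pM2l//; lra.
have h2 : (y * xi) ^+ 2 <= y ^+ 2 * kappa ^+ 2.
  by rewrite exprMn ler_wpM2l ?sqr_ge0//; nra.
have h3 : y ^+ 2 * kappa ^+ 2 <= y ^+ 2 * M * (1 + expR (gamma * z)) by nra.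
have xiE : y * xi = y * z - y * p * t by rewrite /xi; ring.
lra.
Qed.

End ExponentialBounds.

(** * Nonnegative random variables with finite mean *)

(** Means are carried as real numbers, which records finiteness and leaves inequalities between them
    to linear arithmetic. *)
Definition ge0_mean (d : measure_display) (T : measurableType d) (R : realType)
    (P : probability T R) (f : T -> R) (c : R) : Prop :=
  [/\ measurable_fun [set: T] f, (forall w, (0 <= f w)%R) &
      \int[P]_w (f w)%:E = c%:E].

Section Mean.
Context (d : measure_display) (T : measurableType d) (R : realType)
  (P : probability T R).

Lemma ge0_meanD (f g : T -> R) (a b : R) : ge0_mean P f a -> ge0_mean P g b ->
  ge0_mean P (fun w => f w + g w)%R (a + b)%R.
Proof.
move=> [mf f0 fa] [mg g0 gb]; split; first exact: measurable_funD.
  by move=> w; rewrite addr_ge0.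
under eq_integral do rewrite EFinD.
rewrite ge0_integralD ?fa ?gb//; try by move=> w _; rewrite lee_fin.
all: exact/measurable_EFinP.
Qed.

Lemma ge0_meanZ (k : R) (f : T -> R) (a : R) : (0 <= k)%R -> ge0_mean P f a ->
  ge0_mean P (fun w => k * f w)%R (k * a)%R.
Proof.
move=> k0 [mf f0 fa]; split; first exact: measurable_funM.
  by move=> w; rewrite mulr_ge0.
under eq_integral do rewrite EFinM.
rewrite ge0_integralZl_EFin ?fa//; last exact/measurable_EFinP.
by move=> w _; rewrite lee_fin.
Qed.

Lemma ge0_mean_cst (k : R) : (0 <= k)%R -> ge0_mean P (fun=> k) k.
Proof.
move=> k0; split => //.
by rewrite integral_cst//= probability_setT mule1.
Qed.

Lemma ge0_mean_indic (A : set T) : measurable A -> ge0_mean P \1_A (fine (P A)).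
Proof.
move=> mA; split => //.
by rewrite integral_indic// setIT fineK// fin_num_measure.
Qed.

Lemma le_ge0_mean (f g : T -> R) (a b : R) : ge0_mean P f a -> ge0_mean P g b ->
  (forall w, (f w <= g w)%R) -> (a <= b)%R.
Proof.
move=> [mf f0 fa] [mg g0 gb] fg; rewrite -lee_fin -fa -gb.
by apply: ge0_le_integral => //; [move=> w _; rewrite lee_fin|exact/measurable_EFinP|
  exact/measurable_EFinP|move=> w _; rewrite lee_fin].
Qed.

Lemma ge0_mean_ge0 (f : T -> R) (a : R) : ge0_mean P f a -> (0 <= a)%R.
Proof. by move=> fa; apply: le_ge0_mean (ge0_mean_cst (lexx 0)) (fa) _; case: fa. Qed.

Lemma ge0_mean_fin (f : T -> R) : measurable_fun [set: T] f ->
  (forall w, (0 <= f w)%R) -> \int[P]_w (f w)%:E < +oo ->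
  ge0_mean P f (fine (\int[P]_w (f w)%:E)).
Proof.
move=> mf f0 foo; split => //; rewrite fineK// ge0_fin_numE//.
by apply: integral_ge0 => w _; rewrite lee_fin.
Qed.

Lemma ge0_mean_dominated (f g : T -> R) (b : R) : measurable_fun [set: T] f ->
  (forall w, (0 <= f w)%R) -> (forall w, (f w <= g w)%R) -> ge0_mean P g b ->
  ge0_mean P f (fine (\int[P]_w (f w)%:E)).
Proof.
move=> mf f0 fg [mg g0 gb]; apply: ge0_mean_fin => //.
apply: (@le_lt_trans _ _ (\int[P]_w (g w)%:E)); last by rewrite gb ltry.
by apply: ge0_le_integral => //; [move=> w _; rewrite lee_fin|exact/measurable_EFinP|
  exact/measurable_EFinP|move=> w _; rewrite lee_fin].
Qed.

Lemma measurable_superlevel (S : T -> R) (u : R) : measurable_fun [set: T] S ->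
  measurable [set w | (u < S w)%R].
Proof.
move=> mS; rewrite (_ : [set w | _] = S @^-1` `]u, +oo[); last first.
  by apply/seteqP; split => w /=; rewrite in_itv/= andbT.
by rewrite -[X in measurable X]setTI; exact: mS.
Qed.

(** Integrates the pointwise bound of e^(y u) times the indicator of S > u by e^(y S). *)
Lemma chernoff_ge0_mean (S : T -> R) (y u c : R) : (0 <= y)%R ->
  measurable_fun [set: T] S -> ge0_mean P (fun w => expR (y * S w)) c ->
  P [set w | (u < S w)%R] <= (c * expR (- (y * u)))%:E.
Proof.
move=> y0 mS Sc.
have mA := measurable_superlevel u mS.
rewrite -[P _]fineK ?fin_num_measure// lee_fin expRN ler_pdivlMr ?expR_gt0// mulrC.
apply: le_ge0_mean (ge0_meanZ (expR_ge0 (y * u)) (ge0_mean_indic mA)) Sc _ => w.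
rewrite indicE; have [|_] := boolP (w \in _); last by rewrite mulr0 expR_ge0.
by rewrite inE/= mulr1 ler_expR => uS; rewrite ler_wpM2l// ltW.
Qed.

End Mean.

(** * Averages, geometric sums and the mean of one factor *)

(** Extracts finite moments of each variable from hypotheses on averages: a sum of nonnegative terms
    dominates each of them. *)
Lemma mean_le_summand_fin (R : realType) (e : nat -> \bar R) (n i : nat) (nu : R) :
  (forall j, 0 <= e j) -> (i < n)%N ->
  (n%:R^-1)%:E * \sum_(j < n) e j <= nu%:E -> e i < +oo.
Proof.
move=> e0 i_n; have n0 : (0 < n)%N by exact: leq_trans i_n.
rewrite muleC lee_pdivrMr ?ltr0n// => le_nu.
apply: le_lt_trans (ltry (nu * n%:R)%R); apply: le_trans le_nu.
by rewrite (bigD1 (Ordinal i_n))//= leeDl// sume_ge0.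
Qed.

(** AM-GM, which lets hypotheses on averages control variables that are not identically
    distributed. *)
Lemma prodr_le_mean_exp (R : realType) (n : nat) (m : nat -> R) (q : R) :
  (forall i, (0 <= m i)%R) -> (0 < n)%N -> (n%:R^-1 * \sum_(i < n) m i <= q)%R ->
  (\prod_(i < n) m i <= q ^+ n)%R.
Proof.
move=> m0 n0 mq.
have [+ _] := @leif_AGM R 'I_n predT (fun i => m i) (fun i _ => m0 i).
rewrite cardT size_enum_ord => /le_trans; apply.
have s0 : (0 <= \sum_(i < n) m i)%R by apply: sumr_ge0.
rewrite lerXn2r ?nnegrE ?divr_ge0//; last by rewrite mulrC.
by apply: le_trans mq; rewrite mulr_ge0// invr_ge0.
Qed.

(** The first b terms are summed exactly and the others are bounded by their infinite series.
    Exponents start at 1, hence q^(b+1). *)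
Lemma sum_two_geometric_le (R : realType) (a q : R) (b N : nat) : (0 < a)%R ->
  (0 <= q)%R -> (q < 1)%R ->
  (\sum_(n < N) (if (n < b)%N then (1 + a) ^+ n.+1 else q ^+ n.+1) <=
   (1 + a) / a * ((1 + a) ^+ b - 1) + q ^+ b.+1 / (1 - q))%R.
Proof.
move=> a0 q0 q1.
pose h n := (if (n < b)%N then (1 + a) ^+ n.+1 else q ^+ n.+1)%R.
have h0 n : (0 <= h n)%R by rewrite /h; case: ifP => _; rewrite exprn_ge0// addr_ge0// ltW.
(* Extending the range to b + N terms allows a split at b also when N < b. *)
apply: le_trans (sumr_ord_nd h0 (leq_addl b N)) _.
rewrite big_split_ord/=; apply: lerD.
  rewrite (eq_bigr (fun i : 'I_b => (1 + a) * (1 + a) ^+ i)%R); last first.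
    by move=> i _; rewrite /h ltn_ord exprS.
  rewrite -mulr_sumr subrX1 addrAC subrr add0r mulrA divfK// gt_eqF//.
rewrite (eq_bigr (fun i : 'I_N => q ^+ b.+1 * q ^+ i)%R); last first.
  by move=> i _; rewrite /h ltnNge leq_addr/= -exprD addSn.
rewrite -mulr_sumr ler_wpM2l ?exprn_ge0//.
rewrite -[leRHS]mul1r ler_pdivlMr ?subr_gt0//.
have := subrX1 q N; have := exprn_ge0 N q0; lra.
Qed.

(** Takes means in [expR_increment_le]; the finite mean of y p theta is subtracted only
    afterwards. *)
Lemma increment_mgf_le (d : measure_display) (T : measurableType d) (R : realType)
    (P : probability T R) (p kappa gamma y : R) (Z theta : T -> R)
    (mZ mtheta mtail g m : R) :
  (0 < p)%R -> (0 < kappa)%R -> (0 < gamma)%R -> (0 < y)%R -> (y <= gamma / 2)%R ->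
  ge0_mean P Z mZ -> ge0_mean P theta mtheta ->
  ge0_mean P (fun w => theta w * \1_[set w' | (kappa / p <= theta w')%R] w)%R mtail ->
  ge0_mean P (fun w => expR (gamma * Z w)) g ->
  ge0_mean P (fun w => expR (y * Z w + - (y * p) * theta w)) m ->
  (m <= 1 + y * (mZ - p * mtheta) + y * (p * mtail) +
        y ^+ 2 * Num.max (kappa ^+ 2 / 2) (2 / gamma ^+ 2) * (1 + g))%R.
Proof.
move=> p0 k0 g0 y0 yg hZ htheta htail hg hm.
set M := Num.max _ _.
have yp0 : (0 <= y * p)%R by rewrite mulr_ge0// ltW.
have M0 : (0 <= y ^+ 2 * M)%R.
  by rewrite mulr_ge0 ?sqr_ge0// le_max divr_ge0// sqr_ge0.
have := le_ge0_mean (ge0_meanD hm (ge0_meanZ yp0 htheta))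
  (ge0_meanD (ge0_meanD (ge0_meanD (ge0_mean_cst P ler01) (ge0_meanZ (ltW y0) hZ))
    (ge0_meanZ yp0 htail)) (ge0_meanZ M0 (ge0_meanD (ge0_mean_cst P ler01) hg))).
have pw w : (expR (y * Z w + - (y * p) * theta w) + y * p * theta w <=
   1 + y * Z w + y * p * (theta w * \1_[set w' | (kappa / p <= theta w')%R] w) +
   y ^+ 2 * M * (1 + expR (gamma * Z w)))%R.
  have -> : (\1_[set w' | (kappa / p <= theta w')%R] w =
      (kappa / p <= theta w)%R%:R :> R)%R.
    by rewrite indicE; congr ((nat_of_bool _)%:R)%R; apply/idP/idP; rewrite inE.
  have [_ Z0 _] := hZ; have [_ theta0 _] := htheta.
  exact: expR_increment_le.
by move=> /(_ pw); lra.
Qed.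

(** * The exponential bound on the ruin probability *)

Theorem corollary3 (d : measure_display) (T : measurableType d) (R : realType)
    (P : probability T R) (p : R) (Z theta : nat -> {RV P >-> R})
    (model : inhomogeneous_renewal_risk_model p Z theta)
    (alpha : R) (beta : nat) (kappa epsilon gamma nu1 nu2 : R)
    (alpha_gt0 : (0 < alpha)%R) (beta_gt0 : (0 < beta)%N)
    (kappa_gt0 : (0 < kappa)%R) (epsilon_ge0 : (0 <= epsilon)%R)
    (gamma_gt0 : (0 < gamma)%R) (nu1_ge1 : (1 <= nu1)%R)
    (nu2_ge1 : (1 <= nu2)%R)
    (cond_i : forall n : nat, (beta <= n)%N ->
      (n%:R^-1)%:E * \sum_(i < n) ('E_P[Z i] - p%:E * 'E_P[theta i])
        <= (- alpha)%:E)
    (cond_ii : ereal_sup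
      [set (n%:R^-1)%:E * \sum_(i < n)
           'E_P[fun w => (theta i w *
                  \1_[set w' | (kappa / p <= theta i w')%R] w)%R]
      | n in [set n : nat | (beta <= n)%N]] <= epsilon%:E)
    (cond_iii : ereal_sup
      [set (n%:R^-1)%:E * \sum_(i < n) 'E_P[fun w => expR (gamma * Z i w)]
      | n in [set n : nat | (beta <= n)%N]] <= nu1%:E)
    (cond_iv : \big[maxe/-oo]_(1 <= n < beta)
      ((n%:R^-1)%:E * \sum_(i < n) 'E_P[fun w => expR (gamma * Z i w)])
        <= nu2%:E)
    (delta : R) (delta_gt0 : (0 < delta)%R) (delta_le : (delta <= 1 / 2)%R)
    (Delta : R)
    (DeltaE : (- Delta = p * epsilon + delta * gamma * (1 + nu1)
                * Num.max (kappa ^+ 2 / 2) (2 / gamma ^+ 2) - alpha)%R)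
    (Delta_neg : (- Delta < 0)%R) :
  let c2 : R := ((1 + nu2) / nu2 * ((1 + nu2) ^+ beta.-1 - 1)
      + expR (- (delta * gamma * Delta * beta%:R))
        / (1 - expR (- (delta * gamma * Delta))))%R in
  (0 < c2)%R /\
  forall u : R, (0 <= u)%R ->
    ruin_probability p Z theta u
      <= (Num.min 1 (c2 * expR (- (delta * gamma * u))))%R%:E.
Proof.
case: model => p0 Z0 iZ theta0 _ itheta iZtheta c2.
set y := (delta * gamma)%R in DeltaE c2 *.
have y0 : (0 < y)%R by rewrite mulr_gt0.
have yg : (y <= gamma / 2)%R by rewrite /y mulrC ler_pM2l// -[leRHS]div1r.
have nu20 : (0 < nu2)%R := lt_le_trans ltr01 nu2_ge1.
have nu2_ge0 := ltW nu20.
have mZ i : measurable_fun [set: T] (Z i) by [].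
have mtheta i : measurable_fun [set: T] (theta i) by [].
pose tail i w := (theta i w * \1_[set w' | (kappa / p <= theta i w')%R] w)%R.
have mtail i : measurable_fun [set: T] (tail i).
  apply: measurable_funM => //; apply: measurable_indic.
  rewrite (_ : [set w | _] = theta i @^-1` `[(kappa / p)%R, +oo[); last first.
    by apply/seteqP; split => w /=; rewrite in_itv/= andbT.
  exact: measurable_sfunP.
have mexpZ i k : measurable_fun [set: T] (fun w => expR (k * Z i w)).
  by apply: measurableT_comp => //; exact: measurable_funM.
have tail0 i w : (0 <= tail i w)%R by rewrite mulr_ge0.
pose eZ i := fine (\int[P]_w (Z i w)%:E).
pose etheta i := fine (\int[P]_w (theta i w)%:E).
pose etail i := fine (\int[P]_w (tail i w)%:E).
pose g i := fine (\int[P]_w (expR (gamma * Z i w))%:E).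
have cond_iii' n : (beta <= n)%N ->
    (n%:R^-1)%:E * \sum_(i < n) 'E_P[fun w => expR (gamma * Z i w)] <= nu1%:E.
  by move=> bn; apply: le_trans cond_iii; apply: ereal_sup_ubound; exists n.
have cond_ii' n : (beta <= n)%N ->
    (n%:R^-1)%:E * \sum_(i < n) 'E_P[tail i] <= epsilon%:E.
  by move=> bn; apply: le_trans cond_ii; apply: ereal_sup_ubound; exists n.
have E_int (f : T -> R) : \int[P]_w (f w)%:E = 'E_P[f] by rewrite unlock.
(* The length max(beta, i+1) lies in the range of (iii) and its average includes index i, even for i
   < beta. *)
have hg i : ge0_mean P (fun w => expR (gamma * Z i w)) (g i).
  apply: ge0_mean_fin => //.
  rewrite E_int; apply: (@mean_le_summand_fin _
    (fun i => 'E_P[fun w => expR (gamma * Z i w)])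
    (maxn beta i.+1) i nu1).
  - by move=> j; apply: expectation_ge0 => w; exact: expR_ge0.
  - by rewrite leq_max leqnn orbT.
  - by apply: cond_iii'; rewrite leq_maxl.
have htail i : ge0_mean P (tail i) (etail i).
  apply: ge0_mean_fin => //.
  rewrite E_int; apply: (@mean_le_summand_fin _ (fun i => 'E_P[tail i])
    (maxn beta i.+1) i epsilon).
  - by move=> j; exact: expectation_ge0.
  - by rewrite leq_max leqnn orbT.
  - by apply: cond_ii'; rewrite leq_maxl.
(* Z is integrable because gamma Z <= e^(gamma Z). *)
have hZ i : ge0_mean P (Z i) (eZ i).
  have gi0 : (0 <= gamma^-1)%R by rewrite invr_ge0 ltW.
  apply: ge0_mean_dominated (ge0_meanZ gi0 (hg i)) => // w.
  rewrite -ler_pdivrMl ?invr_gt0// invrK; have := expR_ge1Dx (gamma * Z i w); lra.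
(* Off the tail event theta is below kappa/p, so theta <= kappa/p + tail everywhere. *)
have htheta i : ge0_mean P (theta i) (etheta i).
  have kp0 : (0 <= kappa / p)%R by rewrite divr_ge0 ?ltW.
  apply: ge0_mean_dominated (ge0_meanD (ge0_mean_cst P kp0) (htail i)) => // w.
  rewrite /tail indicE; have [_|] := boolP (w \in _); first by rewrite mulr1 lerDr.
  by rewrite notin_setE/= mulr0 addr0 => /negP; rewrite -ltNge => /ltW.
(* Moment generating functions of Z at y and of theta at -y p, finite because y <= gamma and theta
   >= 0. *)
pose a i := fine (\int[P]_w (expR (y * Z i w))%:E).
pose b i := fine (\int[P]_w (expR (- (y * p) * theta i w))%:E).
have yZg i w : (expR (y * Z i w) <= expR (gamma * Z i w))%R.
  by rewrite ler_expR ler_wpM2r//; lra.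
have ha i : ge0_mean P (fun w => expR (y * Z i w)) (a i).
  by apply: ge0_mean_dominated (hg i) => //.
have exp_theta1 i w : (expR (- (y * p) * theta i w) <= 1)%R.
  by rewrite -expR0 ler_expR mulNr oppr_le0 !mulr_ge0// ltW.
have hb i : ge0_mean P (fun w => expR (- (y * p) * theta i w)) (b i).
  apply: ge0_mean_dominated (ge0_mean_cst P ler01) => //.
  by apply: measurableT_comp => //; exact: measurable_funM.
pose xi i w := (y * Z i w + - (y * p) * theta i w)%R.
have mxi i : measurable_fun [set: T] (xi i).
  by apply: measurable_funD; exact: measurable_funM.
have hsum (s : seq nat) : uniq s ->
    ge0_mean P (fun w => expR (\sum_(i <- s) xi i w)) (\prod_(i <- s) (a i * b i))%R.
  move=> us; split.
  - by apply: measurableT_comp => //; exact: measurable_sum.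
  - by move=> w; exact: expR_ge0.
  - apply: integral_expR_sum_indep => //.
    + by move=> i _; case: (ha i).
    + by move=> i _; case: (hb i).
have hxi i : ge0_mean P (fun w => expR (xi i w)) (a i * b i)%R.
  have := hsum [:: i] isT; rewrite big_seq1.
  by under eq_fun do rewrite big_seq1.
have m0 i : (0 <= a i * b i)%R by exact: ge0_mean_ge0 (hxi i).
pose q := expR (- (y * Delta)).
have q0 : (0 <= q)%R by exact: expR_ge0.
have q1 : (q < 1)%R by rewrite -expR0 ltr_expR oppr_lt0 mulr_gt0// -oppr_lt0.
have sum_fine (f : nat -> T -> R) (c : nat -> R) n : (forall i, ge0_mean P (f i) (c i)) ->
    \sum_(i < n) 'E_P[f i] = (\sum_(i < n) c i)%:E.
  by move=> fc; rewrite -sumEFin; apply: eq_bigr => i _; rewrite -E_int; case: (fc i).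
have large n : (beta <= n)%N -> (\prod_(i < n) (a i * b i) <= q ^+ n)%R.
  move=> bn; have n0 : (0 < n)%N by exact: leq_trans bn.
  apply: (@prodr_le_mean_exp _ _ (fun i => (a i * b i)%R)) => //.
  have := cond_ii' _ bn; rewrite (sum_fine _ _ n htail) -EFinM lee_fin => c_ii.
  have := cond_iii' _ bn; rewrite (sum_fine _ _ n hg) -EFinM lee_fin => c_iii.
  have c_i : (n%:R^-1 * \sum_(i < n) (eZ i - p * etheta i) <= - alpha)%R.
    have := cond_i _ bn.
    rewrite (eq_bigr (fun i : 'I_n => (eZ i - p * etheta i)%:E)); last first.
      by move=> i _; rewrite -!E_int; case: (hZ i) => _ _ ->; case: (htheta i) => _ _ ->.
    by rewrite sumEFin -EFinM lee_fin.
  set M := Num.max _ _ in DeltaE.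
  have n_unit : (n%:R^-1 * n%:R = 1 :> R)%R by rewrite mulVf// pnatr_eq0 -lt0n.
  have ni0 : (0 <= n%:R^-1 :> R)%R by rewrite invr_ge0.
  apply: (@le_trans _ _ (n%:R^-1 * \sum_(i < n) (1 + y * (eZ i - p * etheta i)
      + y * (p * etail i) + y ^+ 2 * M * (1 + g i)))%R).
    rewrite ler_wpM2l//; apply: ler_sum => i _.
    exact: increment_mgf_le (hZ i) (htheta i) (htail i) (hg i) (hxi i).
  rewrite !big_split/= -!mulr_sumr sumr_const card_ord.
  (* By (i)-(iii) the average is at most 1 - y alpha + y p epsilon + y^2 M (1 + nu1), which is 1 - y
     Delta since y = delta gamma. *)
  apply: (@le_trans _ _ (1 - y * Delta)%R); last exact: expR_ge1Dx.
  have -> : (\sum_(i < n) (1 + g i) = n%:R + \sum_(i < n) g i)%R.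
    by rewrite big_split/= sumr_const card_ord.
  move: c_i c_ii c_iii n_unit; set A := (\sum_(i < n) (eZ i - _))%R.
  set B := (\sum_(i < n) etail i)%R.
  set G := (\sum_(i < n) g i)%R.
  set k := (n%:R^-1)%R => c_i c_ii c_iii n_unit.
  have -> : (k * (n%:R + y * A + y * (p * B) + y ^+ 2 * M * (n%:R + G)) =
      k * n%:R + y * (k * A) + y * p * (k * B) + y ^+ 2 * M * (k * n%:R + k * G))%R by ring.
  have yp0 : (0 <= y * p)%R by rewrite mulr_ge0// ltW.
  have yM0 : (0 <= y ^+ 2 * M)%R.
    by rewrite mulr_ge0 ?sqr_ge0// le_max divr_ge0// sqr_ge0.
  have hA := ler_wpM2l (ltW y0) c_i.
  have hB := ler_wpM2l yp0 c_ii.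
  have hG := ler_wpM2l yM0 c_iii.
  rewrite n_unit -mulrN DeltaE -/y; nra.
have small n : (0 < n)%N -> (n < beta)%N -> (\prod_(i < n) (a i * b i) <= (1 + nu2) ^+ n)%R.
  (* As b_i <= 1 and a_i <= g_i, (iv) gives nu2^n. Enlarging nu2 to 1 + nu2 keeps the ratio above 1,
     so the closed form of the geometric sum holds even for nu2 = 1. *)
  move=> n0 nb; apply: (@le_trans _ _ (nu2 ^+ n)%R); last first.
    by rewrite lerXn2r ?nnegrE ?addr_ge0 ?lerDr.
  apply: (@prodr_le_mean_exp _ _ (fun i => (a i * b i)%R)) => //.
  have : (n%:R^-1)%:E * \sum_(i < n) 'E_P[fun w => expR (gamma * Z i w)] <= nu2%:E.
    apply: le_trans cond_iv.
    by apply: (@le_bigmax_seq _ _ _ (index_iota 1 beta) -oo n xpredT) => //;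
      rewrite mem_index_iota n0.
  rewrite (sum_fine _ _ n hg) -EFinM lee_fin; apply: le_trans.
  rewrite ler_wpM2l ?invr_ge0//; apply: ler_sum => i _.
  apply: (@le_trans _ _ (a i)); last exact: le_ge0_mean (ha i) (hg i) _.
  rewrite ler_piMr ?(ge0_mean_ge0 (ha i))//.
  exact: le_ge0_mean (hb i) (ge0_mean_cst P ler01) _.
have c2_gt0 : (0 < c2)%R.
  (* For beta = 1 the first summand is 0, so strictness comes from the second. *)
  rewrite /c2 ltr_wpDl//; last by rewrite divr_gt0 ?expR_gt0// subr_gt0.
  by rewrite mulr_ge0 ?subr_ge0 ?exprn_ege1 ?lerDl ?divr_ge0 ?addr_ge0.
split=> // u u0.
pose S n w := (\sum_(i < n) (Z i w - p * theta i w))%R.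
have mS n : measurable_fun [set: T] (S n).
  by apply: measurable_sum => i; apply: measurable_funB => //; exact: measurable_funM.
have mruin n : measurable [set w | (u < S n w)%R] by exact: measurable_superlevel.
have tailS n : P [set w | (u < S n w)%R] <=
    (\prod_(i < n) (a i * b i) * expR (- (y * u)))%:E.
  apply: chernoff_ge0_mean => //; first exact: ltW.
  have := hsum (index_iota 0 n) (iota_uniq _ _); rewrite big_mkord.
  congr (ge0_mean _ _ _); apply/funext => w; congr expR; rewrite big_mkord mulr_sumr.
  by apply: eq_bigr => i _; rewrite /xi; ring.
rewrite /ruin_probability ruin_eventE//; last exact: ltW.
have mU : measurable (\bigcup_n [set w | (u < S n.+1 w)%R]) by exact: bigcup_measurable.
rewrite -/(S _ _).
have bound : P (\bigcup_n [set w | (u < S n.+1 w)%R]) <= (c2 * expR (- (y * u)))%:E.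
  apply: (@le_trans _ _ (\sum_(0 <= n <oo) P [set w | (u < S n.+1 w)%R])).
    exact: generalized_Boole_inequality.
  apply: lime_le; first by apply: is_cvg_nneseries.
  apply: nearW => N.
  (* Term n concerns n+1 claims, so n < beta-1 means n+1 < beta, the range of (iv). *)
  apply: (@le_trans _ _ (\sum_(0 <= n < N) ((if (n < beta.-1)%N then (1 + nu2) ^+ n.+1
       else q ^+ n.+1) * expR (- (y * u)))%:E)).
    apply: lee_sum => n _; apply: le_trans (tailS n.+1) _.
    rewrite lee_fin ler_wpM2r ?expR_ge0//; case: ifPn => nb.
      by apply: small => //; rewrite -ltn_predRL.
    by apply: large; move: nb; rewrite -leqNgt; case: (beta) beta_gt0.
  rewrite sumEFin lee_fin -mulr_suml ler_wpM2r ?expR_ge0// big_mkord.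
  (* With b = beta-1 the exponent b+1 is beta, and q^beta is the numerator in [c2]. *)
  have := @sum_two_geometric_le _ nu2 q beta.-1 N.
  rewrite prednK// => /(_ nu20 q0 q1).
  by rewrite /q -expRM_natr mulNr -/q.
rewrite EFin_min le_min bound andbT.
exact: probability_le1.
Qed.
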